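(* For every generalized Sierpiński carpet $F$, one has $d_I>d_f-d_w$.
   Context: Generalized Sierpiński carpet (GSC). Let $d\ge 2$, $L_F\ge 3$ be integers, $F_0=[0,1]^d$, and for $n\ge 0$ let $\mathcal Q_n$ be the set of the $L_F^{nd}$ closed cubes $\prod_{i=1}^d[(l_i-1)L_F^{-n},l_iL_F^{-n}]$, $1\le l_i\le L_F^n$. For $A\subset\mathbb R^d$ put $\mathcal Q_n(A)=\{Q\in\mathcal Q_n:\operatorname{int}(Q)\cap A\ne\emptyset\}$. For $Q\in\mathcal Q_n$ with lower corner $a_Q$, $\Psi_Q(x)=a_Q+L_F^{-n}x$ maps $F_0$ onto $Q$. Let $F_1\subsetneq F_0$ be a union of cubes in $\mathcal Q_1$, $F_n=\bigcup_{Q\in\mathcal Q_1(F_1)}\Psi_Q(F_{n-1})$ for $n\ge 2$, and $F=\bigcap_{n\ge 0}F_n$. $F$ is a GSC if: (SC1) $F_1$ is preserved by all isometries of $F_0$; (SC2) $\operatorname{int}(F_1)$ is connected; (SC3) if $n\ge 1$ and $B\subset F_0$ is a cube of side length $2L_F^{-n}$ that is the union of $2^d$ distinct elements of $\mathcal Q_n$, then $\operatorname{int}(F_1\cap B)$ is connected whenever it is non-empty; (SC4) $F_1$ contains the segment $\{0\le x_1\le 1,\ x_2=\dots=x_d=0\}$. Dimensions. $m_F=\#\mathcal Q_1(F)$ and $d_f=\log m_F/\log L_F$. $m_I=\#\{Q\in\mathcal Q_1(F):Q\cap\{x_1=0\}\ne\emptyset\}$ and $d_I=\log m_I/\log L_F$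 (the Hausdorff dimension of $F\cap\partial F_0$). The resistance scaling factor $\rho_F>0$ is the unique number such that, for some $C\ge 1$ and all $n\ge0$, $C^{-1}\le (\rho_FL_F^{d-2})^n\inf\{\int_{F_n}|\nabla f|^2dx: f\in W^{1,2}(F_n)\cap C(F_n), f=0 \text{ on }F_n\cap\{x_1=0\}, f=1\text{ on }F_n\cap\{x_1=1\}\}\le C$ (existence of $\rho_F$ is known). $d_w=\log(\rho_Fm_F)/\log L_F$ is the walk dimension. *)

(* Defs.v *)
From HB Require Import structures.
From mathcomp Require Import all_boot all_order all_algebra.
From mathcomp Require Import all_classical all_reals all_analysis.
Set Implicit Arguments.
Unset Strict Implicit.
Unset Printing Implicit Defensive.
Import Order.TTheory GRing.Theory Num.Theory.
Import numFieldNormedType.Exports.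
Local Open Scope classical_set_scope.
Local Open Scope ring_scope.

Section measurable_rV.
Context {R : realType} (n : nat).

Let coord (i : 'I_n) (v : 'rV[R]_n) : R := v ord0 i.

(* The coordinates generate the Borel sigma-algebra of R^n. *)
HB.instance Definition _ :=
  @isMeasurable.Build (measure_tuple_display default_measure_display)
    'rV[R]_n (g_sigma_preimage coord) (@sigma_algebra0 _ _ _)
    (@sigma_algebraC _ _) (@sigma_algebra_bigcup _ _ _).

Lemma measurable_coord (i : 'I_n) :
  measurable_fun [set: 'rV[R]_n] (fun v : 'rV[R]_n => v ord0 i).
Proof.
move=> _ Y mY; rewrite setTI; apply: sub_sigma_algebra => /=.
rewrite -bigcup_seq/=; exists i => /=; first by rewrite mem_index_enum.
by exists Y => //; rewrite setTI.
Qed.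

Lemma measurable_fun_rVP d (T : measurableType d) (f : T -> 'rV[R]_n) :
  (forall i, measurable_fun [set: T] (fun x => f x ord0 i)) ->
  measurable_fun [set: T] f.
Proof.
move=> mf _ Y mY; rewrite setTI.
have : g_sigma_preimage coord `<=` [set A | measurable (f @^-1` A)].
  apply: smallest_sub.
    split => /=.
    - by rewrite preimage_set0.
    - by move=> A mA; rewrite setTD -preimage_setC; exact: measurableC.
    - by move=> F mF; rewrite preimage_bigcup; exact: bigcupT_measurable.
  rewrite -bigcup_seq/= => A [i _] [B mB <-]; rewrite setTI /=.
  by have := mf i measurableT _ mB; rewrite setTI.
by apply.
Qed.

End measurable_rV.

Section lebesgue_step.
Context {R : realType} (n : nat).
Variable mu : {sigma_finite_measure set 'rV[R]_n -> \bar R}.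

Definition cons_rV (p : R * 'rV[R]_n) : 'rV[R]_n.+1 :=
  row_mx (p.1%:M : 'rV[R]_1) p.2.

Definition uncons_rV (v : 'rV[R]_n.+1) : R * 'rV[R]_n :=
  (v ord0 ord0, rsubmx (v : 'rV[R]_(1 + n))).

Lemma cons_rVK : cancel cons_rV uncons_rV.
Proof.
move=> [x v]; rewrite /uncons_rV /cons_rV row_mxKr; congr pair.
have -> : (ord0 : 'I_n.+1) = lshift n (ord0 : 'I_1) by exact/val_inj.
by rewrite (@row_mxEl _ 1 1 n) mxE eqxx.
Qed.

Lemma measurable_cons_rV : measurable_fun [set: R * 'rV[R]_n] cons_rV.
Proof.
apply: measurable_fun_rVP => i; case: (@splitP 1 n i) => [j ij|j ij].
  rewrite (_ : (fun _ => _) = fst)//; apply/funext => p.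
  rewrite (_ : i = lshift n j); last exact/val_inj.
  by rewrite /cons_rV (@row_mxEl _ 1 1 n) mxE (ord1 j) eqxx.
rewrite (_ : (fun _ => _) = (fun v : 'rV[R]_n => v ord0 j) \o snd).
  exact: (measurableT_comp (measurable_coord j)).
apply/funext => p /=.
rewrite (_ : i = rshift 1 j); last exact/val_inj.
by rewrite /cons_rV (@row_mxEr _ 1 1 n).
Qed.

Lemma measurable_uncons_rV : measurable_fun [set: 'rV[R]_n.+1] uncons_rV.
Proof.
apply: measurable_fun_pair; first exact: measurable_coord.
apply: measurable_fun_rVP => i.
rewrite (_ : (fun _ => _) = fun v : 'rV[R]_n.+1 => v ord0 (rshift 1 i)).
  exact: measurable_coord.
by apply/funext => v; rewrite mxE.
Qed.

Definition lebesgue_step : set 'rV[R]_n.+1 -> \bar R :=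
  pushforward (lebesgue_measure \x mu)%E cons_rV.

Let preimage_cons_measurable (A : set 'rV[R]_n.+1) :
  measurable A -> measurable (cons_rV @^-1` A).
Proof. by move=> mA; rewrite -[X in measurable X]setTI; exact: measurable_cons_rV. Qed.

Let step0 : lebesgue_step set0 = 0%E.
Proof. by rewrite /lebesgue_step /pushforward preimage_set0 measure0. Qed.

Let step_ge0 A : (0 <= lebesgue_step A)%E.
Proof. by rewrite /lebesgue_step /pushforward measure_ge0. Qed.

Let step_sigma_additive : semi_sigma_additive lebesgue_step.
Proof.
move=> F mF tF mUF; rewrite /lebesgue_step /pushforward preimage_bigcup.
apply: measure_semi_sigma_additive.
- by move=> k; exact: preimage_cons_measurable.
- apply/trivIsetP => /= i j _ _ ij; rewrite -preimage_setI.
  by move/trivIsetP : tF => /(_ _ _ _ _ ij) ->//; rewrite preimage_set0.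
- by rewrite -preimage_bigcup; exact: preimage_cons_measurable.
Qed.

HB.instance Definition _ := isMeasure.Build _ _ _ lebesgue_step
  step0 step_ge0 step_sigma_additive.

Let step_sigma_finite : sigma_finite setT lebesgue_step.
Proof.
have /sigma_finiteP[F [TF ndF Foo]] :=
  sigma_finiteT (@lebesgue_measure R : {sigma_finite_measure set _ -> \bar R}).
have /sigma_finiteP[G [TG ndG Goo]] := sigma_finiteT mu.
exists (fun k => uncons_rV @^-1` (F k `*` G k)).
  rewrite -preimage_bigcup (_ : \bigcup_i _ = setT) ?preimage_setT//.
  rewrite -setXTT TF TG predeqE => -[x y]; split.
    by move=> [k _ []/= ? ?]; split; exists k.
  move=> [/= [k _ Fkx] [l _ Gly]]; exists (maxn k l) => //; split.
  - by move: x Fkx; exact/subsetPset/ndF/leq_maxl.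
  - by move: y Gly; exact/subsetPset/ndG/leq_maxr.
move=> k; have [? ?] := Foo k; have [? ?] := Goo k; split.
  rewrite -[X in measurable X]setTI; apply: measurable_uncons_rV => //.
  exact: measurableX.
rewrite /lebesgue_step /pushforward (_ : _ @^-1` _ = F k `*` G k).
  by rewrite product_measure1E// lte_mul_pinfty// ge0_fin_numE.
by apply/funext => p; rewrite -[p in RHS]cons_rVK.
Qed.

HB.instance Definition _ := Measure_isSigmaFinite.Build _ _ _ lebesgue_step
  step_sigma_finite.

End lebesgue_step.

Fixpoint lebesgue_rV {R : realType} (n : nat) :
    {sigma_finite_measure set 'rV[R]_n -> \bar R} :=
  if n is m.+1 then lebesgue_step (lebesgue_rV m) else \d_(0 : 'rV[R]_0).

Lemma cons_rV0 {R : realType} n (p : R * 'rV[R]_n) : cons_rV p ord0 ord0 = p.1.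
Proof. by rewrite -[p in RHS]cons_rVK. Qed.

Lemma cons_rVS {R : realType} n (p : R * 'rV[R]_n) (i : 'I_n) :
  cons_rV p ord0 (lift ord0 i) = p.2 ord0 i.
Proof.
rewrite -[p in RHS]cons_rVK [RHS]mxE.
by congr (cons_rV p _ _); exact/val_inj.
Qed.

Lemma lebesgue_rV_box {R : realType} (n : nat) (A : 'I_n -> set R) :
  (forall i, measurable (A i)) ->
  lebesgue_rV n [set v : 'rV[R]_n | forall i, A i (v ord0 i)] =
  (\prod_(i < n) lebesgue_measure (A i))%E.
Proof.
elim: n A => [|n IH] A mA; first by rewrite big_ord0 /= diracE mem_set// => -[].
have mB : measurable [set v : 'rV[R]_n | forall i, A (lift ord0 i) (v ord0 i)].
  rewrite (_ : [set _ | _] =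
      \big[setI/setT]_i (fun v : 'rV[R]_n => v ord0 i) @^-1` A (lift ord0 i)).
    apply: bigsetI_measurable => i _.
    by rewrite -[X in measurable X]setTI; exact: measurable_coord.
  rewrite -bigcap_seq; apply/seteqP; split=> v /=.
    by move=> Av i _; exact: Av.
  by move=> Av i; apply: Av => /=; rewrite mem_index_enum.
rewrite big_ord_recl -IH//= -product_measure1E//; last exact: (mA ord0).
rewrite /lebesgue_step /pushforward.
congr product_measure1; apply/seteqP; split => -[x v] /=.
  move=> Axv; split => [|i] /=; first by have := Axv ord0; rewrite cons_rV0.
  by have := Axv (lift ord0 i); rewrite cons_rVS.
move=> [/= Ax Av] i; case: (unliftP ord0 i) => [j ->|->].
  by rewrite cons_rVS.
by rewrite cons_rV0.
Qed.

Section sobolev.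
Context {R : realType} {d : nat}.
Implicit Types (D U : set 'rV[R]_d) (u f g phi : 'rV[R]_d -> R).

Definition partial (i : 'I_d) f : 'rV[R]_d -> R := 'D_(delta_mx ord0 i) f.

(* C^oo: all iterated partial derivatives exist and are differentiable. *)
Definition smooth phi :=
  forall (s : seq 'I_d) x, differentiable (foldr partial phi s) x.

(* phi \in C_c^oo(U) *)
Definition test_function U phi :=
  let supp := closure [set x | phi x != 0] in
  [/\ smooth phi, compact supp & supp `<=` U].

Definition square_integrable D f :=
  measurable_fun D f /\
  (\int[lebesgue_rV d]_(x in D) (f x ^+ 2)%:E < +oo)%E.

(* For a closed D, weak derivatives are taken on the interior of D. *)
Definition weak_partial D (i : 'I_d) u g :=
  forall phi, test_function D° phi ->
    (\int[lebesgue_rV d]_(x in D) (u x * partial i phi x)%:E =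
     - \int[lebesgue_rV d]_(x in D) (g x * phi x)%:E)%E.

(* u \in W^{1,2}(D) with weak gradient G *)
Definition sobolev12 D u (G : 'I_d -> 'rV[R]_d -> R) :=
  square_integrable D u /\
  forall i, square_integrable D (G i) /\ weak_partial D i u (G i).

End sobolev.

Section carpet.
Context {R : realType} {d : nat} (L : nat).
Implicit Types A F : set 'rV[R]_d.

Definition unit_cube : set 'rV[R]_d :=
  [set x | forall i, 0 <= x ord0 i <= 1].

(* Q_n is indexed by the tuples (l_1 - 1, ..., l_d - 1), so that
   cardinalities of sets of cubes are those of sets of indices. *)
Definition cube_index (n : nat) : finType := {ffun 'I_d -> 'I_(L ^ n)}.

Definition lower_corner n (l : cube_index n) : 'rV[R]_d :=
  \row_i ((l i)%:R / L%:R ^+ n).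

Definition box (a : 'rV[R]_d) (r : R) : set 'rV[R]_d :=
  [set x | forall i, a ord0 i <= x ord0 i <= a ord0 i + r].

Definition cube n (l : cube_index n) : set 'rV[R]_d :=
  box (lower_corner l) (L%:R ^- n).

(* Q_n(A) *)
Definition cubes_of n A : {set cube_index n} :=
  [set l | `[< (cube l)° `&` A !=set0 >]]%SET.

Definition Psi n (l : cube_index n) (x : 'rV[R]_d) : 'rV[R]_d :=
  lower_corner l + L%:R ^- n *: x.

Fixpoint Fn (F1 : set 'rV[R]_d) (n : nat) : set 'rV[R]_d :=
  if n is m.+1 then
    if m is 0 then F1
    else \bigcup_(l in [set` cubes_of 1 F1]) (Psi l @` Fn F1 m)
  else unit_cube.

Definition carpet (F1 : set 'rV[R]_d) : set 'rV[R]_d := \bigcap_n Fn F1 n.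

(* The library's norm on ['rV[R]_d] is the sup norm. *)
Definition euclidean_dist (x y : 'rV[R]_d) : R :=
  Num.sqrt (\sum_i (x ord0 i - y ord0 i) ^+ 2).

Definition isometry_of A (s : 'rV[R]_d -> 'rV[R]_d) :=
  s @` A = A /\
  {in A &, forall x y, euclidean_dist (s x) (s y) = euclidean_dist x y}.

(* {x | x_1 = c} *)
Definition hyperplane (c : R) : set 'rV[R]_d :=
  [set x | forall i : 'I_d, i = 0%N :> nat -> x ord0 i = c].

(* {x | 0 <= x_1 <= 1, x_2 = ... = x_d = 0} *)
Definition edge : set 'rV[R]_d :=
  [set x | forall i : 'I_d,
    if i == 0%N :> nat then 0 <= x ord0 i <= 1 else x ord0 i == 0].

Record is_GSC (F1 : set 'rV[R]_d) : Prop := {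
  GSC_dim : (2 <= d)%N;
  GSC_scale : (3 <= L)%N;
  GSC_union : exists S : {set cube_index 1},
    F1 = \bigcup_(l in [set` S]) cube l;
  GSC_proper : F1 `<` unit_cube;
  GSC_symmetry : forall s, isometry_of unit_cube s -> s @` F1 = F1;
  GSC_connected : connected F1°;
  GSC_nondiagonal : forall n (a : 'rV[R]_d) (S : {set cube_index n}),
    let B := box a (2 / L%:R ^+ n) in
    (1 <= n)%N -> B `<=` unit_cube ->
    #|S| = (2 ^ d)%N -> B = \bigcup_(l in [set` S]) cube l ->
    (F1 `&` B)° !=set0 -> connected (F1 `&` B)°;
  GSC_edge : edge `<=` F1
}.

Definition m_F (F1 : set 'rV[R]_d) : nat := #|cubes_of 1 (carpet F1)|.

Definition m_I (F1 : set 'rV[R]_d) : nat :=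
  #|[set l in cubes_of 1 (carpet F1) |
      `[< cube l `&` hyperplane 0 !=set0 >]]%SET|.

Definition d_f (F1 : set 'rV[R]_d) : R := ln (m_F F1)%:R / ln L%:R.

Definition d_I (F1 : set 'rV[R]_d) : R := ln (m_I F1)%:R / ln L%:R.

(* The infimum also runs over the weak gradient G, which is unique up to a
   null set on the interior of F_n; the boundary of F_n is null. *)
Definition min_energy (F1 : set 'rV[R]_d) (n : nat) : \bar R :=
  ereal_inf [set E | exists u G, [/\ sobolev12 (Fn F1 n) u G,
    {within Fn F1 n, continuous u},
    forall x, (Fn F1 n `&` hyperplane 0) x -> u x = 0,
    forall x, (Fn F1 n `&` hyperplane 1) x -> u x = 1 &
    E = (\int[lebesgue_rV d]_(x in Fn F1 n) (\sum_i G i x ^+ 2)%:E)%E]].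

(* [d - 2] is truncated; it is only used under [GSC_dim]. *)
Definition is_resistance_scaling (F1 : set 'rV[R]_d) (rho : R) :=
  0 < rho /\
  exists2 C : R, 1 <= C & forall n,
    (C^-1%:E <= ((rho * L%:R ^+ (d - 2)) ^+ n)%:E * min_energy F1 n <= C%:E)%E.

Definition d_w (F1 : set 'rV[R]_d) (rho : R) : R := ln (rho * (m_F F1)%:R) / ln L%:R.

End carpet.

(* Main.v *)
Require Import Defs.
From mathcomp Require Import all_boot all_order all_algebra.
From mathcomp Require Import all_classical all_reals all_analysis.
From mathcomp Require Import measurable_realfun.
From mathcomp Require Import ring lra.
Set Implicit Arguments.
Unset Strict Implicit.
Unset Printing Implicit Defensive.
Import Order.TTheory GRing.Theory Num.Theory.
Import numFieldNormedType.Exports.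
Local Open Scope classical_set_scope.
Local Open Scope ring_scope.

(** Since d_f - d_w = - ln rho / ln L, the claim says that rho * m_I > 1; in
    fact rho * m_I >= 2. Because (rho L^(d-2))^n times the minimal energy on
    F_n stays bounded below, it is enough to exhibit competitors whose energy
    on F_n is O((m_I / (2 L^(d-2)))^n).

    The competitors depend on the first coordinate only: u(x) = g_n(x_1), where
    g_n approximates a Cantor function. From a C^1 step g_0 one iterates
      g_(n+1)(t) = (g_n(L t) + g_n(L t - (L - 1))) / 2,
    so that g_n climbs from 0 to 1 inside the 2^n intervals of length L^-n whose
    base-L digits are all 0 or L - 1. There its slope is at most 2 (L/2)^n.
    A level-n cube of F_n lying above such an interval is coded by n cubes of
    F_1, each in the first or in the last layer orthogonal to the first axis;
    by symmetry each of these two layers has at most m_I cubes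
    ([card_first_layer_le], [card_end_layers_le]). The gradient
    is thus supported on (2 m_I)^n cubes of volume L^(-n d), and the energy
    is at most
      4 (L/2)^(2n) (2 m_I)^n L^(-n d) = 4 (m_I / (2 L^(d-2)))^n
    ([min_energy_le]). Letting only the two extreme layers of each generation
    share the increment is what gains the factor 2 over the function that climbs
    from 0 to 1 within the layer of width L^-n along the face x_1 = 0; the latter
    only gives rho * m_I >= 1.

    Two points need care. The weak gradient of x |-> g(x_1) has to be identified
    on F_n: as test functions vanish outside the interior of F_n, this reduces to
    the fact that the integral over R^d of a compactly supported partial
    derivative vanishes, which is Fubini and the fundamental theorem of calculus
    ([integral_partial_eq0], [weak_partial_ridge]). And m_I counts cubes meeting
    the carpet F, whereas the energy bound counts cubes of F_1: every cube of F_1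
    contains a point of F in its interior, because F has a point in the interior
    of the unit cube, namely (1/L, ..., 1/L) ([cubes_of_carpet]). *)

(** * Integrals of compactly supported derivatives in R^n *)

Section calculus.
Context {R : realType}.
Local Notation lambda := (@lebesgue_measure R).

Lemma integral_compactly_supported_derivative (F f : R -> R) (M : R) :
  (forall t : R, is_derive t (1:R) F (f t)) -> continuous f ->
  (forall t, M <= `|t| -> F t = 0 /\ f t = 0) ->
  (\int[lambda]_t (f t)%:E = 0)%E.
Proof.
move=> dF cf supp.
(* [M] may be nonpositive, whereas the integration interval [- N, N] must be
   nondegenerate. *)
pose N := `|M| + 1.
have N0 : 0 < N by rewrite ltr_wpDl.
have MN : M <= N by rewrite (le_trans (ler_norm M))// lerDl.
have suppN t : N <= `|t| -> F t = 0 /\ f t = 0.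
  by move=> Nt; apply: supp; exact: le_trans Nt.
have cF : continuous F.
  move=> t; apply: differentiable_continuous; apply/derivable1_diffP.
  by have [] := dF t.
have NN : - N < N by rewrite gtrN.
have -> : (\int[lambda]_t (f t)%:E = \int[lambda]_(t in `[(- N)%R, N]) (f t)%:E)%E.
  rewrite [RHS]integral_mkcond; apply: eq_integral => t _.
  rewrite /patch; case: ifPn => // tN.
  have [|_ ->//] := suppN t.
  rewrite leNgt; apply/negP => tN'; move/negP: tN; apply; rewrite inE /=.
  by rewrite in_itv /= -ler_norml ltW.
rewrite (@continuous_FTC2 _ f F _ _ NN (continuous_subspaceT cf)).
- have [|-> _] := suppN N; first by rewrite ger0_norm// ltW.
  have [|-> _] := suppN (- N); first by rewrite normrN ger0_norm// ltW.
  by rewrite sube0.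
- split.
  + by move=> t _; have [] := dF t.
  + exact: cvg_at_right_filter (cF _).
  + exact: cvg_at_left_filter (cF _).
- move=> t _; rewrite derive1E.
  by have [_ ->] := dF t.
Qed.

Lemma bounded_supported_integrable d (T : measurableType d)
    (mu : {measure set T -> \bar R}) (f : T -> R) (K : set T) (B : R) :
  measurable K -> (mu K < +oo)%E -> measurable_fun setT f ->
  (forall x, `|f x| <= B) -> (forall x, ~ K x -> f x = 0) ->
  mu.-integrable setT (EFin \o f).
Proof.
move=> mK Kfin mf fB f0.
have -> : EFin \o f = (EFin \o f) \_ K.
  apply/funext => x; rewrite /patch; case: ifPn => // /negP xK /=.
  by rewrite f0// => Kx; apply: xK; rewrite inE.
apply/(integrable_mkcond _ mK)/measurable_bounded_integrable => //.
  exact: measurable_funTS.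
by exists B; split; [exact: num_real|move=> C BC x _; exact: le_trans (ltW BC)].
Qed.

End calculus.

Section lebesgue_rV_theory.
Context {R : realType}.

Lemma measurable_coord_set n (A : 'I_n -> set R) :
  (forall i, measurable (A i)) ->
  measurable [set v : 'rV[R]_n | forall i, A i (v ord0 i)].
Proof.
move=> mA.
rewrite (_ : [set _ | _] = \bigcap_(i in [set: 'I_n]) (fun v : 'rV[R]_n => v ord0 i) @^-1` A i).
  apply: fin_bigcap_measurable; first exact: finite_finset.
  by move=> i _; rewrite -[X in measurable X]setTI; exact: measurable_coord.
by apply/seteqP; split => v /= Av i; [move=> _; exact: Av|exact: Av].
Qed.

Lemma boxE n (a : 'rV[R]_n) r :
  box a r = [set v | forall i, `[a ord0 i, a ord0 i + r]%classic (v ord0 i)].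
Proof. by apply/seteqP; split => v /= h i; have := h i; rewrite in_itv. Qed.

Lemma measurable_box n (a : 'rV[R]_n) r : measurable (box a r).
Proof. rewrite boxE.
apply: (@measurable_coord_set n (fun i => `[a ord0 i, a ord0 i + r]%classic)) => i.
exact: measurable_itv.
 Qed.

Lemma lebesgue_box n (a : 'rV[R]_n) r : 0 <= r ->
  lebesgue_rV n (box a r) = (r ^+ n)%:E.
Proof.
move=> r0; rewrite boxE.
rewrite (@lebesgue_rV_box _ _ (fun i => `[a ord0 i, a ord0 i + r]%classic));
  last by move=> i; exact: measurable_itv.
rewrite (eq_bigr (fun=> r%:E)).
  by rewrite prodEFin prodr_const card_ord.
move=> i _; rewrite lebesgue_measure_itv/= lte_fin ltrDl.
case: (ltgtP 0 r) r0 => // [r0 _|<- _//].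
by rewrite -EFinD addrAC subrr add0r.
Qed.

Lemma row_ballP n (x y : 'rV[R]_n) e : 0 < e ->
  ball x e y <-> forall i, `|x ord0 i - y ord0 i| < e.
Proof.
move=> e0; split => [[_ h] i|h]; first exact: h.
by split => // i j; rewrite (ord1 i); exact: h.
Qed.

(** The sigma-algebra on row vectors is generated by the coordinates, so this is
    the second countability of R^n: an open set is the union of the rational
    boxes that it contains. *)
Lemma open_measurable_rV n (U : set 'rV[R]_n) : open U -> measurable U.
Proof.
move=> oU.
pose I := ('rV[rat]_n * nat)%type.
pose c (q : I) : 'rV[R]_n := map_mx ratr q.1.
pose e (q : I) : R := q.2.+1%:R^-1.
pose C (q : I) : set 'rV[R]_n :=
  [set v | forall i, `](c q ord0 i - e q), (c q ord0 i + e q)[%classic (v ord0 i)].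
have inC q v : C q v <-> forall i, `|c q ord0 i - v ord0 i| < e q.
  by split => h i; have := h i; rewrite /= in_itv/= ltr_distlC.
pose D (q : I) := if `[< C q `<=` U >] then C q else set0.
have -> : U = \bigcup_q D q.
  apply/seteqP; split => [x Ux|x [q _]]; last first.
    by rewrite /D; case: ifPn => // /asboolP CU /CU.
  have /nbhs_ballP[r /= r0 xrU] : nbhs x U by exact: open_nbhs_nbhs.
  have [k kr] : exists k : nat, k.+1%:R^-1 < r / 2.
    have r20 : 0 < r / 2 by rewrite divr_gt0.
    by have [k _ h] := near_infty_natSinv_lt (PosNum r20); exists k; exact: (h k (leqnn k)).
  have ek0 : 0 < k.+1%:R^-1 :> R by rewrite invr_gt0.
  have /choice[f fP] : forall i, exists q : rat,
      `|ratr q - x ord0 i| < k.+1%:R^-1.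
    move=> i; have [|q] := @rat_in_itvoo R (x ord0 i) (x ord0 i + k.+1%:R^-1).
      by rewrite ltrDl.
    rewrite in_itv/= => /andP[q1 q2]; exists q; rewrite ger0_norm ?subr_ge0 1?ltW//.
    by rewrite ltrBlDl.
  exists (\row_i f i, k) => //.
  have Cx : C (\row_i f i, k) x by apply/inC => i; rewrite !mxE; exact: fP.
  rewrite /D; case: ifPn => // /negP; elim; apply/asboolP => y /inC Cy.
  apply: xrU; apply/row_ballP => // i; move/inC : Cx => /(_ i) Cx.
  rewrite (le_lt_trans (ler_distD (c (\row_i f i, k) ord0 i) _ _))//.
  rewrite (splitr r) ltrD//.
    by rewrite distrC; exact: lt_trans Cx kr.
  exact: lt_trans (Cy i) kr.
apply: countable_bigcupT_measurable; first exact: countableP.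
move=> q; rewrite /D; case: ifPn => // _.
apply: (@measurable_coord_set n
  (fun i => `](c q ord0 i - e q), (c q ord0 i + e q)[%classic)) => i.
exact: measurable_itv.
Qed.

Lemma continuous_measurable_rV n (f : 'rV[R]_n -> R) :
  continuous f -> measurable_fun setT f.
Proof.
move=> cf; apply: (measurability _ (RGenOInfty.measurableE R)) => //.
move=> _ [_ [a ->] <-]; rewrite setTI; apply: open_measurable_rV.
by apply: open_comp; [move=> x _; exact: cf|exact: interval_open].
Qed.

End lebesgue_rV_theory.

Section divergence.
Context {R : realType}.
Local Notation lambda := (@lebesgue_measure R).

(** The absolute value makes this a genuine cube whatever the sign of [M], so
    that bounds on supports can be used without a sign condition. *)
Definition origin_cube n (M : R) : set 'rV[R]_n := box (const_mx (- `|M|)) (`|M| *+ 2).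

Lemma notin_origin_cube n (M : R) (x : 'rV[R]_n) :
  ~ origin_cube M x -> exists j, M <= `|x ord0 j|.
Proof.
move=> xM; apply/not_existsP => h; apply: xM => j.
have /negP := h j; rewrite -ltNge => /ltW xj; rewrite mxE.
have := le_trans xj (ler_norm M); rewrite ler_norml => /andP[-> /=].
by rewrite mulr2n addKr.
Qed.

Lemma lebesgue_origin_cube_lty n (M : R) : (lebesgue_rV n (origin_cube M) < +oo)%E.
Proof. by rewrite lebesgue_box ?ltry// mulrn_wge0. Qed.

Lemma integrable_bounded_support n (f : 'rV[R]_n -> R) (M B : R) :
  measurable_fun setT f -> (forall x, `|f x| <= B) ->
  (forall (x : 'rV[R]_n) j, M <= `|x ord0 j| -> f x = 0) ->
  (lebesgue_rV n).-integrable setT (EFin \o f).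
Proof.
move=> mf fB f0.
apply: (@bounded_supported_integrable _ _ _ _ _ (origin_cube M) B) => //.
- exact: measurable_box.
- exact: lebesgue_origin_cube_lty.
- by move=> x /notin_origin_cube[j]; exact: f0.
Qed.

Lemma cons_rV_shift0 n (t : R) (v : 'rV[R]_n) :
  cons_rV (t, v) = cons_rV (0, v) + t *: delta_mx ord0 ord0.
Proof.
apply/rowP => j; rewrite [RHS]mxE [X in _ + X]mxE [X in _ * X]mxE /=.
case: (unliftP ord0 j) => [k ->|->].
  by rewrite !cons_rVS /= mulr0 addr0.
by rewrite !cons_rV0 /= mulr1 add0r.
Qed.

Lemma cons_rV_shiftS n (t x : R) (v : 'rV[R]_n) (j : 'I_n) :
  cons_rV (x, v + t *: delta_mx ord0 j) =
  cons_rV (x, v) + t *: delta_mx ord0 (lift ord0 j).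
Proof.
apply/rowP => k; rewrite [RHS]mxE [X in _ = _ + X]mxE [X in _ = _ + _ * X]mxE /=.
case: (unliftP ord0 k) => [l ->|->].
  by rewrite !cons_rVS /= !mxE /= (inj_eq lift_inj).
by rewrite !cons_rV0 /= mulr0 addr0.
Qed.

(** Regularity is required only along the lines parallel to the i-th axis, with
    joint measurability: these hypotheses pass to the slices [cons_rV (x, .)],
    which allows an induction on the dimension following the recursive
    definition of the Lebesgue measure. For i = 0 the first variable is
    integrated first and the one-dimensional result applies; otherwise the
    remaining variables are, and the induction hypothesis applies. *)
Lemma integral_partial_eq0 n (i : 'I_n) (Phi Psi : 'rV[R]_n -> R) (M B : R) :
  measurable_fun setT Psi -> (forall x, `|Psi x| <= B) ->
  (forall (x : 'rV[R]_n) j, M <= `|x ord0 j| -> Phi x = 0 /\ Psi x = 0) ->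
  (forall x (t : R), is_derive t (1:R) (fun s : R => Phi (x + s *: delta_mx ord0 i))
                               (Psi (x + t *: delta_mx ord0 i))) ->
  (forall x, continuous (fun t : R => Psi (x + t *: delta_mx ord0 i))) ->
  (\int[lebesgue_rV n]_x (Psi x)%:E = 0)%E.
Proof.
elim: n i Phi Psi => [[]//|n IH] i Phi Psi mPsi PsiB supp dPhi cPsi.
have mPsic : measurable_fun setT (Psi \o @cons_rV R n).
  exact: measurableT_comp (@measurable_cons_rV _ _).
have iPsic : (lambda \x lebesgue_rV n)%E.-integrable setT (EFin \o (Psi \o @cons_rV R n)).
  apply: (@bounded_supported_integrable R _ _ (lambda \x lebesgue_rV n)%E
    (Psi \o @cons_rV R n) (@cons_rV R n @^-1` origin_cube M) B) => //.
  - by rewrite -[X in measurable X]setTI; apply: measurable_cons_rV => //; exact: measurable_box.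
  - exact: (@lebesgue_origin_cube_lty n.+1 M).
  - by move=> x; exact: PsiB.
  - by move=> x /notin_origin_cube[j] /supp[].
have -> : (\int[lebesgue_rV n.+1]_x (Psi x)%:E =
    \int[lambda \x lebesgue_rV n]_z ((Psi \o @cons_rV R n) z)%:E)%E.
  transitivity (\int[pushforward (lambda \x lebesgue_rV n) (@cons_rV R n)]_x (Psi x)%:E)%E.
    by [].
  rewrite integral_pushforward ?preimage_setT//; first exact: measurable_cons_rV.
  exact/measurable_EFinP.
case: (unliftP ord0 i) => [j ij|i0].
- rewrite -integral12_prod_meas1//; apply: integral0_eq => x _.
  apply: (IH j (fun v => Phi (cons_rV (x, v)))).
  + exact: measurable_fun_pair2 mPsic.
  + by move=> v; exact: PsiB.
  + by move=> v k; rewrite -(cons_rVS (x, v)); exact: supp.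
  + move=> v t /=; under eq_fun do rewrite cons_rV_shiftS -ij.
    by rewrite /= cons_rV_shiftS -ij.
  + move=> v /=; under eq_fun do rewrite cons_rV_shiftS -ij. exact: cPsi.
- rewrite -integral21_prod_meas1//; apply: integral0_eq => v _.
  have shift (f : 'rV[R]_n.+1 -> R) : (fun t : R => f (cons_rV (t, v))) =
      (fun t : R => f (cons_rV (0, v) + t *: delta_mx ord0 i)).
    by apply/funext => t; rewrite cons_rV_shift0 -i0.
  apply: (@integral_compactly_supported_derivative _
    (fun t : R => Phi (cons_rV (t, v))) (fun t : R => Psi (cons_rV (t, v))) M).
  + by move=> t; rewrite shift (cons_rV_shift0 t v) -i0; exact: dPhi.
  + by rewrite shift; exact: cPsi.
  + by move=> t tM; apply: (supp _ ord0); rewrite cons_rV0.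
Qed.

End divergence.

(** * Weak derivatives of functions of the first coordinate *)

Section ridge_functions.
Context {R : realType}.

Lemma is_derive_along_line n (f : 'rV[R]_n -> R) (x v : 'rV[R]_n) (t : R) :
  differentiable f (x + t *: v) ->
  is_derive t (1:R) (fun s : R => f (x + s *: v)) ('D_v f (x + t *: v)).
Proof.
move=> df; have fv : derivable f (x + t *: v) v by exact: diff_derivable.
have E : (fun h : R => h^-1 *: (((fun s : R => f (x + s *: v)) \o shift t) (h *: (1:R))
            - (fun s : R => f (x + s *: v)) t)) =
    (fun h : R => h^-1 *: ((f \o shift (x + t *: v)) (h *: v) - f (x + t *: v))).
  apply/funext => h /=; congr (_ *: (f _ - _)).
  rewrite (_ : h *: (1:R) = h); last exact: mulr1.
  by rewrite scalerDl addrCA.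
by split; rewrite /derivable /derive E.
Qed.

Lemma compact_support_bounded n (f : 'rV[R]_n -> R) (K : set 'rV[R]_n) :
  compact K -> continuous f -> (forall x, ~ K x -> f x = 0) ->
  exists B, forall x, `|f x| <= B.
Proof.
move=> cK cf f0.
have : bounded_set (f @` K).
  exact/compact_bounded/continuous_compact/cK/continuous_subspaceT.
move=> /pinfty_ex_gt0[B _ fB]; exists (Num.max 0 B) => x; rewrite le_max.
have [Kx|/f0 ->] := pselect (K x); last by rewrite normr0 lexx.
by apply/orP; right; apply: fB; exists x.
Qed.

(** The partial derivative vanishes off the support because the support is
    closed, so that the function vanishes near every point outside it. *)
Lemma test_function_bounds n (U : set 'rV[R]_n) phi (i : 'I_n) :
  test_function U phi ->
  exists M B : R, [/\ forall x, `|phi x| <= B, forall x, `|partial i phi x| <= B,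
    forall (x : 'rV[R]_n) j, M <= `|x ord0 j| -> phi x = 0 /\ partial i phi x = 0 &
    forall x, ~ U x -> phi x = 0 /\ partial i phi x = 0].
Proof.
move=> [sphi]; set K := closure _ => cK KU.
have phi0 x : ~ K x -> phi x = 0.
  move=> Kx; apply/eqP/negPn/negP => p0; apply: Kx; exact: subset_closure.
have dphi0 x : ~ K x -> partial i phi x = 0.
  move=> Kx; rewrite /partial (@near_eq_derive _ _ _ phi (cst 0)) ?derive_cst//.
  have : nbhs x (~` K).
    by apply: open_nbhs_nbhs; split => //; rewrite openC; exact: closed_closure.
  by apply: filterS => y Ky; rewrite phi0.
have cphi : continuous phi.
  by move=> x; apply: differentiable_continuous; exact: (sphi [::] x).
have cdphi : continuous (partial i phi).
  by move=> x; apply: differentiable_continuous; exact: (sphi [:: i] x).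
have [B1 hB1] := compact_support_bounded cK cphi phi0.
have [B2 hB2] := compact_support_bounded cK cdphi dphi0.
have /pinfty_ex_gt0[M _ KM] := compact_bounded cK.
exists (M + 1), (Num.max B1 B2); split.
- by move=> x; rewrite le_max hB1.
- by move=> x; rewrite le_max hB2 orbT.
- move=> x j Mx; suff Kx : ~ K x by rewrite phi0// dphi0.
  move=> /KM /=; rewrite leNgt => /negP; apply.
  rewrite (lt_le_trans _ (le_trans Mx _)) ?ltrDl//.
  rewrite [leRHS]mx_normrE.
  by apply: (le_trans _ (le_bigmax _ _ (ord0, j))).
- by move=> x Ux; have Kx : ~ K x by [move=> /KU]; rewrite phi0// dphi0.
Qed.

(** The product of u(x) = g(x_1) with a test function phi is compactly supported,
    so the integral of its i-th partial derivative
      phi * d_i u + u * d_i phi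
    is zero; and integrating over D or over the whole space makes no difference,
    since phi vanishes outside the interior of D. *)
Lemma weak_partial_ridge n (D : set 'rV[R]_n.+1) (i : 'I_n.+1) (g g1 : R -> R) (A : R) :
  (forall t : R, is_derive t (1:R) g (g1 t)) -> continuous g1 ->
  (forall t, `|g t| <= A) -> (forall t, `|g1 t| <= A) ->
  weak_partial D i (fun x => g (x ord0 ord0))
    (fun x => if i == ord0 then g1 (x ord0 ord0) else 0).
Proof.
move=> dg cg1 gA g1A phi tphi.
have [M [B [phiB dphiB supp suppD]]] := test_function_bounds i tphi.
have {tphi} [sphi _ _] := tphi.
set G := fun x : 'rV[R]_n.+1 => if i == ord0 then g1 (x ord0 ord0) else 0.
set u := fun x : 'rV[R]_n.+1 => g (x ord0 ord0).
have A0 : 0 <= A by exact: le_trans (normr_ge0 _) (gA 0).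
have cphi : continuous phi.
  by move=> x; apply: differentiable_continuous; exact: (sphi [::] x).
have cdphi : continuous (partial i phi).
  by move=> x; apply: differentiable_continuous; exact: (sphi [:: i] x).
have cg : continuous g.
  move=> t; apply: differentiable_continuous; apply/derivable1_diffP.
  by have [] := dg t.
have mu : measurable_fun setT u.
  exact: measurableT_comp (continuous_measurable_fun cg) (measurable_coord ord0).
have mG : measurable_fun setT G.
  rewrite /G; case: (i == ord0); last exact: measurable_cst.
  exact: measurableT_comp (continuous_measurable_fun cg1) (measurable_coord ord0).
have uA x : `|u x| <= A by exact: gA.
have GA x : `|G x| <= A by rewrite /G; case: ifP => // _; rewrite normr0.
pose f1 x := u x * partial i phi x.
pose f2 x := G x * phi x.
have mf1 : measurable_fun setT f1.
  by apply: measurable_funM => //; exact: continuous_measurable_rV.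
have mf2 : measurable_fun setT f2.
  by apply: measurable_funM => //; exact: continuous_measurable_rV.
have f1B x : `|f1 x| <= A * B by rewrite normrM ler_pM.
have f2B x : `|f2 x| <= A * B by rewrite normrM ler_pM.
have if1 : (lebesgue_rV n.+1).-integrable setT (EFin \o f1).
  apply: (integrable_bounded_support mf1 f1B (M := M)) => x j /supp[_ h].
  by rewrite /f1 h mulr0.
have if2 : (lebesgue_rV n.+1).-integrable setT (EFin \o f2).
  apply: (integrable_bounded_support mf2 f2B (M := M)) => x j /supp[h _].
  by rewrite /f2 h mulr0.
have toT (f : 'rV[R]_n.+1 -> R) : (forall x, ~ D° x -> f x = 0) ->
    (\int[lebesgue_rV n.+1]_(x in D) (f x)%:E = \int[lebesgue_rV n.+1]_x (f x)%:E)%E.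
  move=> f0; rewrite integral_mkcond; apply: eq_integral => x _.
  rewrite /patch; case: ifPn => // /negP xD; rewrite f0// => /interior_subset xD'.
  by apply: xD; rewrite inE.
rewrite (toT f1); last by move=> x /suppD[_ h]; rewrite /f1 h mulr0.
rewrite (toT f2); last by move=> x /suppD[h _]; rewrite /f2 h mulr0.
have : (\int[lebesgue_rV n.+1]_x (f1 x + f2 x)%:E = 0)%E.
  apply: (@integral_partial_eq0 _ _ i (fun x => u x * phi x) _ M (A * B + A * B)).
  - exact: measurable_funD.
  - by move=> x; rewrite (le_trans (ler_normD _ _))// lerD.
  - by move=> x j /supp[h1 h2]; rewrite /f1 /f2 h1 h2 !mulr0 addr0.
  - move=> x t; set y := x + t *: delta_mx ord0 i.
    have du : is_derive t (1:R) (fun s : R => u (x + s *: delta_mx ord0 i)) (G y).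
      have -> : (fun s : R => u (x + s *: delta_mx ord0 i)) =
          g \o (fun s : R => x ord0 ord0 + s * (i == ord0)%:R).
        by apply/funext => s; rewrite /u !mxE /= eq_sym.
      have Gy : G y = g1 (x ord0 ord0 + t * (i == ord0)%:R) * (i == ord0)%:R.
        rewrite /G /y !mxE /= (eq_sym ord0 i).
        by case: (i == ord0); rewrite ?(mulr1, mulr0).
      rewrite Gy; apply: is_derive1_comp.
      set k := (i == ord0)%:R.
      have -> : (fun s : R => x ord0 ord0 + s * k) = (cst (x ord0 ord0) + k \*: id)%R.
        by apply/funext => s; rewrite mulrC.
      apply: (is_derive_eq (is_deriveD (is_derive_cst _ _ _) (is_deriveZ _ (is_derive_id _ _)))).
      by rewrite add0r; exact: mulr1.
    have dphi := is_derive_along_line (sphi [::] y).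
    apply: (is_derive_eq (is_deriveM du dphi)).
    by rewrite /f1 /f2 -/y [X in _ = _ + X]mulrC.
  - have cG : continuous G.
      rewrite /G; case: (i == ord0); last exact: cst_continuous.
      by move=> x; apply: (continuous_comp (@coord_continuous _ _ _ ord0 ord0 x)); exact: cg1.
    have cu : continuous u.
      by move=> x; apply: (continuous_comp (@coord_continuous _ _ _ ord0 ord0 x)); exact: cg.
    move=> x t; apply: (@continuous_comp _ _ _ (fun s : R => x + s *: delta_mx ord0 i)
      (fun y => f1 y + f2 y)).
      apply: cvgD; first exact: cvg_cst.
      exact: scalel_continuous.
    by apply: continuousD; apply: continuousM => //; [exact: cu|exact: cdphi|exact: cG|exact: cphi].
under eq_integral do rewrite EFinD.
rewrite (integralD _ if1 if2)//.
have fin1 := integrable_fin_num measurableT if1.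
have fin2 := integrable_fin_num measurableT if2.
rewrite -(fineK fin1) -(fineK fin2) -EFinD -EFinN => -[/eqP].
by rewrite addr_eq0 => /eqP ->.
Qed.

End ridge_functions.

(** * Continuously differentiable approximations of a Cantor function *)

Section smoothed_cantor_function.
Context {R : realType}.

Definition pos_part (x : R) : R := Num.max 0 x.

Lemma pos_part_ge0 x : 0 <= x -> pos_part x = x.
Proof. by move=> x0; apply: max_r. Qed.

Lemma pos_part_le0 x : x <= 0 -> pos_part x = 0.
Proof. by move=> x0; apply: max_l. Qed.

Lemma continuous_pos_part : continuous pos_part.
Proof.
by move=> x; apply: continuous_max; [exact: cvg_cst|exact: cvg_id].
Qed.

Lemma is_derive_sqr_pos_part (x : R) :
  is_derive x (1:R) (fun t : R => pos_part t ^+ 2) (2 * pos_part x).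
Proof.
have [x0|x0|->] := ltgtP x 0.
- rewrite pos_part_le0 ?ltW// mulr0.
  apply: (@near_eq_is_derive _ _ _ (cst (0:R) : R -> R)).
  near=> t; rewrite pos_part_le0 ?expr0n//.
  by apply: ltW; near: t; exact: lt_nbhsl.
- rewrite pos_part_ge0 ?ltW//.
  apply: (@near_eq_is_derive _ _ _ (fun t : R => t ^+ 2)).
    near=> t; rewrite pos_part_ge0//.
    by apply: ltW; near: t; exact: lt_nbhsr.
  apply: is_derive_eq.
  by rewrite (_ : x *: (1:R) = x); [rewrite mulr_natl mulr2n|exact: mulr1].
- rewrite pos_part_le0// mulr0.
  have E : (h^-1 *: (((fun t : R => pos_part t ^+ 2) \o shift (0:R)) (h *: (1:R)) -
      pos_part 0 ^+ 2) @[h --> (0:R)^']) --> (0 : R).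
    have C : pos_part h @[h --> (0:R)^'] --> (0 : R).
      have := @continuous_pos_part 0; rewrite /continuous_at pos_part_le0// => C.
      exact: cvg_within_filter C.
    apply: cvg_trans C.
    apply: near_eq_cvg; near=> h.
    have h0 : h != 0 by near: h; exact: nbhs_dnbhs_neq.
    rewrite /= addr0 (_ : h *: (1:R) = h); last exact: mulr1.
    rewrite (pos_part_le0 (lexx 0)) expr0n subr0.
    have [h1|h1] := leP h 0; first by rewrite pos_part_le0// expr0n scaler0.
    by rewrite pos_part_ge0 ?ltW// expr2 /GRing.scale /= mulKf.
  by split; [apply/cvg_ex; exists 0|exact: cvg_lim E].
Unshelve. all: by end_near. Qed.

(** The quadratic spline with knots 0, 1/2, 1 whose derivative is the tent of
    integral 1 over [0, 1]: a C^1 step from 0 to 1. *)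
Definition spline_step (x : R) : R :=
  2 * (pos_part x ^+ 2 - 2 * pos_part (x - 2^-1) ^+ 2 + pos_part (x - 1) ^+ 2).

Definition tent (x : R) : R :=
  4 * (pos_part x - 2 * pos_part (x - 2^-1) + pos_part (x - 1)).

Lemma is_derive_spline_step (x : R) : is_derive x (1:R) spline_step (tent x).
Proof.
have sh (a : R) : is_derive x (1:R) (fun t => pos_part (t - a) ^+ 2) (2 * pos_part (x - a)).
  have da : is_derive x (1:R) (fun t => t - a) 1 by apply: is_derive_eq; rewrite subr0.
  have := @is_derive1_comp R (fun t => pos_part t ^+ 2) (fun t => t - a) x _ _
    (is_derive_sqr_pos_part (x - a)) da.
  by rewrite mulr1.
have h := is_deriveZ 2 (is_deriveD (is_deriveB (is_derive_sqr_pos_part x)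
  (is_deriveZ 2 (sh 2^-1))) (sh 1)).
apply: (is_derive_eq h); rewrite /tent /GRing.scale /=; ring.
Qed.

Lemma pos_partP x : x <= 0 /\ pos_part x = 0 \/ 0 <= x /\ pos_part x = x.
Proof.
have [x0|x0] := leP x 0; [left|right; split; first exact: ltW].
  by rewrite pos_part_le0.
by rewrite pos_part_ge0// ltW.
Qed.

Ltac pos_part_cases x :=
  case: (pos_partP x) => -[? ->]; case: (pos_partP (x - 2^-1)) => -[? ->];
  case: (pos_partP (x - 1)) => -[? ->].

Lemma spline_step_le0 x : x <= 0 -> spline_step x = 0.
Proof. by move=> x0; rewrite /spline_step; pos_part_cases x; nra. Qed.

Lemma spline_step_ge1 x : 1 <= x -> spline_step x = 1.
Proof. by move=> x0; rewrite /spline_step; pos_part_cases x; nra. Qed.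

Lemma spline_step_itv x : 0 <= spline_step x <= 1.
Proof. by apply/andP; rewrite /spline_step; pos_part_cases x; split; nra. Qed.

Lemma tent_itv x : 0 <= tent x <= 2.
Proof. by apply/andP; rewrite /tent; pos_part_cases x; split; lra. Qed.

Lemma tent_le0 x : x <= 0 -> tent x = 0.
Proof. by move=> x0; rewrite /tent; pos_part_cases x; lra. Qed.

Lemma tent_ge1 x : 1 <= x -> tent x = 0.
Proof. by move=> x0; rewrite /tent; pos_part_cases x; lra. Qed.

Lemma continuous_tent : continuous tent.
Proof.
have sh (a : R) : continuous (fun t => pos_part (t - a)).
  move=> x; apply: (@continuous_comp _ _ _ (fun t => t - a) pos_part).
    by apply: cvgB; [exact: cvg_id|exact: cvg_cst].
  exact: continuous_pos_part.
move=> x; apply: cvgM; first exact: cvg_cst.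
apply: cvgD; last exact: sh.
apply: cvgB; first exact: continuous_pos_part.
by apply: cvgM; [exact: cvg_cst|exact: sh].
Qed.


Variable L : nat.
Local Notation l := (L%:R : R).

(** As the step is constant outside [0, 1], the two terms climb on the disjoint
    intervals [0, 1/L] and [1 - 1/L, 1], and no case distinction is needed to
    glue the two copies. *)
Fixpoint cantor_fun (n : nat) (x : R) : R :=
  if n is m.+1 then 2^-1 * (cantor_fun m (l * x) + cantor_fun m (l * x - (l - 1)))
  else spline_step x.

Fixpoint cantor_deriv (n : nat) (x : R) : R :=
  if n is m.+1 then l / 2 * (cantor_deriv m (l * x) + cantor_deriv m (l * x - (l - 1)))
  else tent x.

Lemma is_derive_cantor_fun n (x : R) :
  is_derive x (1:R) (cantor_fun n) (cantor_deriv n x).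
Proof.
elim: n x => [|n IH] x; first exact: is_derive_spline_step.
have da (a : R) : is_derive x (1:R) (fun t => l * t - a) l.
  have h := is_deriveB (is_deriveZ l (is_derive_id x (1:R))) (is_derive_cst a x (1:R)).
  by apply: (is_derive_eq h); rewrite subr0; exact: mulr1.
have dn (a : R) : is_derive x (1:R) (fun t => cantor_fun n (l * t - a))
    (cantor_deriv n (l * x - a) * l).
  exact: (@is_derive1_comp R (cantor_fun n) (fun t => l * t - a) x _ _ (IH _) (da a)).
have dn0 : is_derive x (1:R) (fun t => cantor_fun n (l * t)) (cantor_deriv n (l * x) * l).
  by have := dn 0; under eq_fun do rewrite subr0; rewrite subr0.
have h := is_deriveZ 2^-1 (is_deriveD dn0 (dn (l - 1))).
apply: (is_derive_eq h).
by rewrite /= /GRing.scale /=; ring.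
Qed.

Lemma continuous_cantor_deriv n : continuous (cantor_deriv n).
Proof.
elim: n => [|n IH]; first exact: continuous_tent.
have sh (a : R) : continuous (fun t => cantor_deriv n (l * t - a)).
  move=> x; apply: (@continuous_comp _ _ _ (fun t => l * t - a) (cantor_deriv n)).
    apply: cvgB; last exact: cvg_cst.
    by apply: cvgM; [exact: cvg_cst|exact: cvg_id].
  exact: IH.
have sh0 : continuous (fun t => cantor_deriv n (l * t)).
  by have := sh 0; under eq_fun do rewrite subr0.
move=> x; apply: cvgM; first exact: cvg_cst.
by apply: cvgD; [exact: sh0|exact: sh].
Qed.

Hypothesis L2 : (2 <= L)%N.

Let l2 : 2 <= l. Proof. by rewrite ler_nat. Qed.

Let scale_le0 x : x <= 0 -> l * x <= 0 /\ l * x - (l - 1) <= 0.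
Proof.
move=> x0; have lx : l * x <= 0 by rewrite mulr_ge0_le0.
by have := l2; split => //; lra.
Qed.

Let scale_ge1 x : 1 <= x -> 1 <= l * x /\ 1 <= l * x - (l - 1).
Proof.
move=> x1; have lx : l <= l * x by rewrite ler_peMr.
by have := l2; split; lra.
Qed.

Lemma cantor_fun_le0 n x : x <= 0 -> cantor_fun n x = 0.
Proof.
elim: n x => [|n IH] x x0 /=; first exact: spline_step_le0.
by have [h1 h2] := scale_le0 x0; rewrite !IH ?addr0 ?mulr0.
Qed.

Lemma cantor_fun_ge1 n x : 1 <= x -> cantor_fun n x = 1.
Proof.
elim: n x => [|n IH] x x0 /=; first exact: spline_step_ge1.
by have [h1 h2] := scale_ge1 x0; rewrite !IH//; field.
Qed.

Lemma cantor_fun_itv n x : 0 <= cantor_fun n x <= 1.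
Proof.
elim: n x => [|n IH] x /=; first exact: spline_step_itv.
by have := IH (l * x); have := IH (l * x - (l - 1)); lra.
Qed.

Lemma cantor_deriv_le0 n x : x <= 0 -> cantor_deriv n x = 0.
Proof.
elim: n x => [|n IH] x x0 /=; first exact: tent_le0.
by have [h1 h2] := scale_le0 x0; rewrite !IH ?addr0 ?mulr0.
Qed.

Lemma cantor_deriv_ge1 n x : 1 <= x -> cantor_deriv n x = 0.
Proof.
elim: n x => [|n IH] x x0 /=; first exact: tent_ge1.
by have [h1 h2] := scale_ge1 x0; rewrite !IH ?addr0 ?mulr0.
Qed.

(** At every point one of the two terms of the recursion vanishes, since
    [L t < 1] and [0 < L t - (L - 1)] exclude each other: the bound is
    multiplied by L / 2, not by L. *)
Lemma cantor_deriv_itv n x : 0 <= cantor_deriv n x <= 2 * (l / 2) ^+ n.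
Proof.
elim: n x => [|n IH] x; first by rewrite mulr1; exact: tent_itv.
rewrite exprS mulrCA /=.
have l0 : 0 < l / 2 by have := l2; lra.
rewrite pmulr_rge0// ler_pM2l//.
have [h|h] := leP 1 (l * x).
  by rewrite (cantor_deriv_ge1 _ h) add0r.
by rewrite (@cantor_deriv_le0 _ (l * x - (l - 1))) ?addr0//; have := l2; lra.
Qed.

End smoothed_cantor_function.

(** * Cubes and their similarities *)

Section carpet_geometry.
Context {R : realType} {d : nat} (L : nat).
Hypothesis L2 : (2 <= L)%N.
Local Notation l := (L%:R : R).
Implicit Types (x y a : 'rV[R]_d) (q : @cube_index d L 1).

Let l0 : 0 < l. Proof. by rewrite ltr0n (leq_trans _ L2). Qed.

Lemma interior_boxP a r x :
  (box a r)° x <-> forall i, a ord0 i < x ord0 i < a ord0 i + r.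
Proof.
split=> [/nbhs_ballP[e /= e0 xe] i|h].
  have near_x (t : R) : `|t| < e -> box a r (x + t *: delta_mx ord0 i).
    move=> te; apply: xe; apply/row_ballP => // j.
    rewrite !mxE opprD addNKr normrN; case: (_ && _); first by rewrite mulr1.
    by rewrite mulr0 normr0.
  have e2 : `|e / 2| < e by rewrite ger0_norm; lra.
  have := near_x _ e2 i; have := near_x (- (e / 2)).
  rewrite normrN => /(_ e2 i); rewrite !mxE !eqxx /=; lra.
pose lo := (fun i => x ord0 i - a ord0 i); pose hi := (fun i => a ord0 i + r - x ord0 i).
pose e : R := \big[Num.min/1]_i Num.min (lo i) (hi i).
have e0 : 0 < e.
  rewrite /e; apply: (big_ind (fun z : R => 0 < z)) => //.
  - by move=> u v u0 v0; rewrite lt_min u0.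
  - by move=> i _; have := h i; rewrite lt_min /lo /hi; lra.
apply/nbhs_ballP; exists e => // y /row_ballP => /(_ e0) xy i.
have := xy i; have : e <= Num.min (lo i) (hi i) by exact: bigmin_le_cond.
by rewrite le_min ltr_distlC /lo /hi; lra.
Qed.

Lemma coord_cube q i : (q i < L)%N.
Proof. by rewrite -[X in (_ < X)%N](expn1 L); exact: ltn_ord. Qed.

Lemma coord_cubeR q i : 0 <= ((q i)%:R : R) <= l - 1.
Proof.
rewrite ler0n lerBrDr natr1 ler_nat; exact: coord_cube.
Qed.

Lemma PsiE q x i : Psi q x ord0 i = l^-1 * ((q i)%:R + x ord0 i).
Proof. by rewrite /Psi /lower_corner !mxE !expr1 mulrDr mulrC. Qed.

Lemma unit_cubeE : @unit_cube R d = box 0 1.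
Proof.
by apply/seteqP; split => x h i; have := h i; rewrite mxE add0r.
Qed.

Lemma cubeP q x : cube q x <-> forall i, (q i)%:R <= l * x ord0 i <= (q i)%:R + 1.
Proof.
split => h i; have := h i; rewrite /lower_corner mxE !expr1.
  rewrite ler_pdivrMr// (mulrC _ l) => /andP[-> /=] h2.
  by rewrite -(ler_pdivlMl _ _ l0) mulrDr mulr1 mulrC.
move=> /andP[h1 h2]; rewrite ler_pdivrMr// (mulrC _ l) h1 /=.
by move: h2; rewrite -(ler_pdivlMl _ _ l0) mulrDr mulr1 mulrC.
Qed.

Lemma interior_cubeP q x :
  (cube q)° x <-> forall i, (q i)%:R < l * x ord0 i < (q i)%:R + 1.
Proof.
rewrite /cube interior_boxP; split => h i; have := h i; rewrite /lower_corner mxE !expr1.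
  rewrite ltr_pdivrMr// (mulrC _ l) => /andP[-> /=] h2.
  by rewrite -(ltr_pdivlMl _ _ l0) mulrDr mulr1 mulrC.
move=> /andP[h1 h2]; rewrite ltr_pdivrMr// (mulrC _ l) h1 /=.
by move: h2; rewrite -(ltr_pdivlMl _ _ l0) mulrDr mulr1 mulrC.
Qed.

Lemma interior_cube_inj q q' x : (cube q)° x -> cube q' x -> q = q'.
Proof.
move=> /interior_cubeP h /cubeP h'; apply/ffunP => i; apply/val_inj/eqP => /=.
have /andP[h1 h2] := h i; have /andP[h3 h4] := h' i.
have : ((q i)%:R < (q' i)%:R + 1 :> R) by exact: lt_le_trans h4.
have : ((q' i)%:R < (q i)%:R + 1 :> R) by exact: le_lt_trans h2.
by rewrite !natr1 !ltr_nat !ltnS eqn_leq => -> ->.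
Qed.

Lemma Psi_inE q x i : l * Psi q x ord0 i = (q i)%:R + x ord0 i.
Proof. by rewrite PsiE mulVKf// gt_eqF. Qed.

Lemma image_Psi_unit_cube q : Psi q @` @unit_cube R d = cube q.
Proof.
apply/seteqP; split => [_ [x ux <-]|y /cubeP yq].
  by apply/cubeP => i; rewrite Psi_inE; have := ux i; lra.
exists (\row_i (l * y ord0 i - (q i)%:R)).
  by move=> i; rewrite mxE; have := yq i; lra.
apply/rowP => i; apply: (mulfI (lt0r_neq0 l0)).
by rewrite Psi_inE mxE addrC subrK.
Qed.

Lemma cube_sub_unit_cube q : cube q `<=` @unit_cube R d.
Proof.
move=> x /cubeP h i; have := h i; have := coord_cubeR q i => h1 h2.
have lx0 : 0 <= l * x ord0 i by lra.
have lx1 : l * x ord0 i <= l * 1 by lra.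
by move: lx0 lx1; rewrite pmulr_rge0// ler_pM2l// => -> ->.
Qed.

Lemma box_Psi q a r x : box a r x -> box (Psi q a) (l^-1 * r) (Psi q x).
Proof.
move=> h i; rewrite !PsiE -mulrDr !ler_pM2l ?invr_gt0//.
by have := h i; lra.
Qed.

Lemma measurable_image_Psi q (A : set 'rV[R]_d) : measurable A -> measurable (Psi q @` A).
Proof.
move=> mA; pose inv (y : 'rV[R]_d) : 'rV[R]_d := \row_i (l * y ord0 i - (q i)%:R).
have PsiK : cancel (Psi q) inv.
  by move=> x; apply/rowP => i; rewrite mxE Psi_inE addrC addKr.
have invK : cancel inv (Psi q).
  move=> y; apply/rowP => i; apply: (mulfI (lt0r_neq0 l0)).
  by rewrite Psi_inE mxE addrC subrK.
have -> : Psi q @` A = inv @^-1` A.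
  apply/seteqP; split => [_ [x Ax <-]|y Ay]; first by rewrite /= PsiK.
  by exists (inv y).
rewrite -[X in measurable X]setTI.
suff : measurable_fun setT inv by apply.
apply: measurable_fun_rVP => i; under eq_fun do rewrite mxE.
apply: measurable_funB; last exact: measurable_cst.
apply: measurable_funM; first exact: measurable_cst.
exact: measurable_coord.
Qed.

End carpet_geometry.

(** * Cubes of a generalized Sierpinski carpet *)

Section carpet_cubes.
Context {R : realType} {d : nat} (L : nat) (F1 : set 'rV[R]_d.+1).
Hypothesis hF : is_GSC L F1.
Local Notation l := (L%:R : R).
Local Notation Q := (cubes_of L 1 F1).
Implicit Types (x y a : 'rV[R]_d.+1) (q : @cube_index d.+1 L 1).

Let L2 : (2 <= L)%N. Proof. exact: ltnW (GSC_scale hF). Qed.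
Let l0 : 0 < l. Proof. by rewrite ltr0n (leq_trans _ L2). Qed.
Let l2 : 2 <= l. Proof. by rewrite ler_nat. Qed.

Definition cube_center q : 'rV[R]_d.+1 := \row_i (l^-1 * ((q i)%:R + 2^-1)).

Lemma cube_center_interior q : (cube q)° (cube_center q).
Proof. by apply/(interior_cubeP L2) => i; rewrite mxE mulVKf ?gt_eqF//; lra. Qed.

Lemma GSC_cubes : F1 = \bigcup_(q in [set` Q]) cube q.
Proof.
have [S FS] := GSC_union hF.
suff -> : Q = S by [].
apply/setP => q; rewrite inE; apply/asboolP/idP => [[x [xq]]|qS].
  by rewrite FS => -[q' /= q'S xq']; rewrite (interior_cube_inj L2 xq xq').
exists (cube_center q); split; first exact: cube_center_interior.
by rewrite FS; exists q => //; apply: interior_subset; exact: cube_center_interior.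
Qed.

Lemma cubes_ofP q x : (cube q)° x -> F1 x -> q \in Q.
Proof. by move=> xq Fx; rewrite inE; apply/asboolP; exists x. Qed.

Lemma cube_sub_GSC q : q \in Q -> cube q `<=` F1.
Proof. by move=> qQ x xq; rewrite GSC_cubes; exists q. Qed.

Lemma FnS n : Fn L F1 n.+1 = \bigcup_(q in [set` Q]) (Psi q @` Fn L F1 n).
Proof.
case: n => [|//]; rewrite [LHS]GSC_cubes /=.
by apply: eq_bigcupr => q _; rewrite (image_Psi_unit_cube L2).
Qed.

Lemma Fn_sub_unit_cube n : Fn L F1 n `<=` unit_cube.
Proof.
elim: n => [//|n IH]; rewrite FnS => _ [q qQ [x /IH ux <-]].
by apply: (cube_sub_unit_cube L2 (q := q)); rewrite -(image_Psi_unit_cube L2); exists x.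
Qed.

Lemma measurable_Fn n : measurable (Fn L F1 n).
Proof.
elim: n => [|n IH]; first by rewrite /= unit_cubeE; exact: measurable_box.
rewrite FnS; apply: fin_bigcup_measurable; first exact: finite_finset.
by move=> q _; exact: measurable_image_Psi.
Qed.

(** This single isometry of the unit cube is enough: it maps the corner 0 to the
    opposite corner and exchanges the first and last layers of cubes. *)
Definition central_symmetry x : 'rV[R]_d.+1 := const_mx 1 - x.

Lemma central_symmetryK : involutive central_symmetry.
Proof. by move=> x; rewrite /central_symmetry subKr. Qed.

Lemma GSC_central_symmetry x : F1 x -> F1 (central_symmetry x).
Proof.
move=> Fx; rewrite -(GSC_symmetry hF (s := central_symmetry)); first by exists x.
have stable y : unit_cube y -> unit_cube (central_symmetry y).
  by move=> h i; rewrite !mxE; have := h i; lra.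
split.
  apply/seteqP; split => [_ [y uy <-]|y uy]; first exact: stable.
  by exists (central_symmetry y); [exact: stable|exact: central_symmetryK].
move=> y z _ _; rewrite /euclidean_dist; congr Num.sqrt; apply: eq_bigr => i _.
by rewrite !mxE; ring.
Qed.

Definition rev_cube q : @cube_index d.+1 L 1 := [ffun i => rev_ord (q i)].

Lemma rev_cubeE q i : (rev_cube q i)%:R = l - 1 - (q i)%:R :> R.
Proof.
rewrite ffunE /= natrB; last exact: ltn_ord.
by rewrite (_ : (L ^ 1)%:R = l); [rewrite -natr1; ring|rewrite expn1].
Qed.

Lemma rev_cubeK : involutive rev_cube.
Proof. by move=> q; apply/ffunP => i; rewrite !ffunE rev_ordK. Qed.

Lemma rev_cubes_of q : q \in Q -> rev_cube q \in Q.
Proof.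
move=> qQ; apply: (@cubes_ofP _ (central_symmetry (cube_center q))).
  apply/(interior_cubeP L2) => i; rewrite !mxE rev_cubeE mulrBr mulVKf ?gt_eqF//.
  by lra.
apply: GSC_central_symmetry; apply: (cube_sub_GSC qQ).
by apply: interior_subset; exact: cube_center_interior.
Qed.

Let L1 : (0 < L ^ 1)%N. Proof. by rewrite expn1 (leq_trans _ L2). Qed.

Definition corner_cube : @cube_index d.+1 L 1 := [ffun=> Ordinal L1].

(** The point at distance 1 / (2 L) from the origin on the first axis is in
    [F1], and no other cube contains it. *)
Lemma corner_cube_of : corner_cube \in Q.
Proof.
pose x : 'rV[R]_d.+1 := \row_i (if i == ord0 then (2 * l)^-1 else 0).
have : F1 x.
  apply: (GSC_edge hF) => i; have -> : (i == 0%N :> nat) = (i == ord0) by [].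
  rewrite mxE; case: (i == ord0); last exact: eqxx.
  by have h2 := l2; rewrite invr_ge0 invf_le1; lra.
move=> Fx; have [q /= qQ /(cubeP L2) xq] : (\bigcup_(q in [set` Q]) cube q) x.
  by rewrite -GSC_cubes.
suff -> : corner_cube = q by [].
apply/ffunP => i; rewrite ffunE; apply/val_inj/eqP => /=.
have /andP[+ _] := xq i; rewrite mxE; case: ifP => _ h.
  have : (q i)%:R < 1 :> R.
    apply: le_lt_trans h _; rewrite invfM mulrCA mulfV ?gt_eqF//; lra.
  by rewrite ltrn1 ltnS leqn0 => /eqP ->.
by move: h; rewrite mulr0 lern0 => /eqP ->.
Qed.

(** The vertex (1, ..., 1) is the fixed point of the similarity onto the corner
    cube that contains it. *)
Lemma const1_Fn n : Fn L F1 n (const_mx 1).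
Proof.
have revQ := rev_cubes_of corner_cube_of.
elim: n => [|n IH]; first by move=> i; rewrite mxE ler01 lexx.
rewrite FnS; exists (rev_cube corner_cube) => //; exists (const_mx 1) => //.
apply/rowP => i; rewrite PsiE rev_cubeE ffunE /= mxE.
by rewrite subr0 subrK mulVf// gt_eqF.
Qed.

(** The corner cube at the origin carries the vertex (1, ..., 1) to this point,
    which is interior to the unit cube as 0 < 1 / L < 1. *)
Lemma carpet_interior_point n : Fn L F1 n (const_mx l^-1).
Proof.
case: n => [|n].
  by move=> i; rewrite mxE invr_ge0 invf_le1; have := l2; lra.
rewrite FnS; exists corner_cube; first exact: corner_cube_of.
exists (const_mx 1); first exact: const1_Fn.
by apply/rowP => i; rewrite PsiE ffunE /= !mxE add0r mulr1.
Qed.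

(** A cube of [F1] contains a copy of the carpet, hence the image of a point of
    the carpet interior to the unit cube. *)
Lemma cubes_of_carpet q : q \in Q -> q \in cubes_of L 1 (carpet L F1).
Proof.
move=> qQ; rewrite inE; apply/asboolP; exists (Psi q (const_mx l^-1)); split.
  apply/(interior_cubeP L2) => i; rewrite (Psi_inE L2) mxE.
  have : 0 < l^-1 < 1 by rewrite invr_gt0 invf_lt1//; have := l2; lra.
  by lra.
have : cube q (Psi q (const_mx l^-1)).
  rewrite -(image_Psi_unit_cube L2); exists (const_mx l^-1) => //.
  exact: (carpet_interior_point 0).
move=> xq [|n] _; first exact: (cube_sub_unit_cube L2 (q := q)).
rewrite FnS; exists q => //; exists (const_mx l^-1) => //.
exact: carpet_interior_point.
Qed.

Definition first_layer : {set @cube_index d.+1 L 1} := [set q in Q | q ord0 == 0 :> nat]%SET.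

Definition end_layers : {set @cube_index d.+1 L 1} :=
  [set q in Q | (q ord0 == 0 :> nat) || (q ord0 == L.-1 :> nat)]%SET.

Lemma card_first_layer_le : (#|first_layer| <= m_I L F1)%N.
Proof.
rewrite /m_I; apply: subset_leq_card; apply/fintype.subsetP => q.
rewrite [q \in first_layer]inE => /andP[qQ /eqP q0].
rewrite inE (cubes_of_carpet qQ) /=.
apply/asboolP; exists (Psi q 0); split.
  rewrite -(image_Psi_unit_cube L2); exists 0 => // i.
  by rewrite mxE lexx ler01.
move=> i i0; have -> : i = ord0 by exact/val_inj.
by rewrite PsiE q0 mxE addr0 mulr0.
Qed.

Lemma card_end_layers_le : (#|end_layers| <= 2 * #|first_layer|)%N.
Proof.
rewrite mul2n -addnn -[X in (_ <= _ + X)%N](card_imset _ (inv_inj rev_cubeK)).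
apply: leq_trans (leq_card_setU _ _).
apply: subset_leq_card; apply/fintype.subsetP => q.
rewrite [q \in end_layers]inE finset.in_setU => /andP[qQ /orP[q0|q1]].
  by apply/orP; left; rewrite inE qQ q0.
apply/orP; right.
apply/imsetP; exists (rev_cube q); last by rewrite rev_cubeK.
rewrite inE (rev_cubes_of qQ) /=.
by rewrite ffunE /= (eqP q1) expn1; case: (L) L2 => //= k _; rewrite subnn.
Qed.

Lemma m_F_gt0 : (0 < m_F L F1)%N.
Proof. by apply/card_gt0P; exists corner_cube; apply: cubes_of_carpet; exact: corner_cube_of. Qed.

End carpet_cubes.

(** * Upper bound on the energy and conclusion *)

Section energy_bound.
Context {R : realType} {d : nat} (L : nat) (F1 : set 'rV[R]_d.+1).
Hypothesis hF : is_GSC L F1.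
Local Notation l := (L%:R : R).
Local Notation Q := (cubes_of L 1 F1).
Local Notation T := (end_layers L F1).
Local Notation mu := (lebesgue_rV d.+1 : {sigma_finite_measure set 'rV[R]_d.+1 -> \bar R}).
Implicit Types (x y a : 'rV[R]_d.+1) (q : @cube_index d.+1 L 1).

Let L2 : (2 <= L)%N. Proof. exact: ltnW (GSC_scale hF). Qed.
Let l0 : 0 < l. Proof. by rewrite ltr0n (leq_trans _ L2). Qed.

(** Corners of the level-n cubes coded by words in the cubes of the two extreme
    layers. *)
Fixpoint cover_corners (n : nat) : seq 'rV[R]_d.+1 :=
  if n is m.+1 then [seq Psi q a | q <- enum T, a <- cover_corners m] else [:: 0].

Lemma size_cover_corners n : size (cover_corners n) = (#|T| ^ n)%N.
Proof. by elim: n => [//|n IH]; rewrite size_allpairs IH -cardE expnS. Qed.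

(** If x is the image of y under the similarity of the cube q, then L x_1 equals
    q_1 + y_1 with y_1 in [0, 1], and the derivative at level n + 1 combines the
    derivatives at level n at q_1 + y_1 and at q_1 + y_1 - (L - 1). As those
    vanish outside the open unit interval, q_1 is 0 or L - 1, and the derivative
    at level n does not vanish at y_1. *)
Lemma cover_cantor_deriv_support n x : Fn L F1 n x ->
  cantor_deriv L n (x ord0 ord0) != 0 ->
  exists2 a, a \in cover_corners n & box a (l^-1 ^+ n) x.
Proof.
elim: n x => [|n IH] x.
  by move=> ux _; exists 0; [rewrite inE|rewrite expr0 -unit_cubeE].
rewrite (FnS hF) => -[q /= qQ [y Fy <-]].
rewrite -/(cantor_deriv L n.+1 _) [cantor_deriv _ _ _]/=.
rewrite (Psi_inE L2) => dx.
have [y0 y1] : 0 <= y ord0 ord0 /\ y ord0 ord0 <= 1.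
  by apply/andP; exact: (Fn_sub_unit_cube hF Fy).
have [qT dy] : q \in T /\ cantor_deriv L n (y ord0 ord0) != 0.
  have supp (z : R) : cantor_deriv L n z != 0 -> 0 < z < 1.
    move=> z0; rewrite !ltNge; apply/andP; split; apply: contraNN z0 => z0; apply/eqP.
      exact: cantor_deriv_le0.
    exact: cantor_deriv_ge1.
  have : cantor_deriv L n ((q ord0)%:R + y ord0 ord0) != 0 \/
         cantor_deriv L n ((q ord0)%:R + y ord0 ord0 - (l - 1)) != 0.
    apply/orP; rewrite -negb_and; apply: contraNN dx => /andP[/eqP -> /eqP ->].
    by rewrite addr0 mulr0.
  move=> [] h; have := supp _ h => /andP[h1 h2].
    have q0 : q ord0 = 0%N :> nat.
      by apply/eqP; rewrite -leqn0 -ltnS -(ltr_nat R); lra.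
    move: h; rewrite q0 add0r; split => //.
    by rewrite inE qQ q0 eqxx.
  have q1 : q ord0 = L.-1 :> nat.
    apply/eqP; rewrite eqn_leq -ltnS (ltn_predK L2) coord_cube//=.
    rewrite -subn1 leq_subLR add1n -ltnS -(ltr_nat R) -!natr1; lra.
  have q1R : (q ord0)%:R = l - 1 :> R.
    by rewrite q1 -[in RHS](ltn_predK L2) -natr1 addrK.
  move: h; rewrite q1R addrC addKr; split => //.
  by rewrite inE qQ q1 eqxx orbT.
have [a aC ya] := IH _ Fy dy.
exists (Psi q a); last by rewrite exprS; exact: box_Psi.
by apply/allpairsP; exists (q, a); rewrite mem_enum.
Qed.

Lemma measure_union_boxes (s : seq 'rV[R]_d.+1) (r : R) : 0 <= r ->
  measurable (\big[setU/set0]_(a <- s) box a r) /\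
  (mu (\big[setU/set0]_(a <- s) box a r) <= ((size s)%:R * r ^+ d.+1)%:E)%E.
Proof.
move=> r0; elim: s => [|a s [mIH IH]].
  by rewrite big_nil measure0 mul0r; split.
rewrite big_cons; split; first by apply: measurableU => //; exact: measurable_box.
apply: (le_trans (measureU2 _ _ _)) => //; first exact: measurable_box.
by rewrite -[size _]/(size s).+1 -natr1 addrC mulrDl mul1r EFinD -(lebesgue_box a r0) leeD.
Qed.

Lemma lebesgue_Fn_lty n : (mu (Fn L F1 n) < +oo)%E.
Proof.
apply: (@le_lt_trans _ _ (mu (box 0 1))); last by rewrite lebesgue_box// ltry.
apply: le_measure; rewrite ?inE; [exact: measurable_Fn hF _|exact: measurable_box|].
by rewrite -unit_cubeE; exact: (Fn_sub_unit_cube hF).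
Qed.

Lemma square_integrable_bounded n (f : 'rV[R]_d.+1 -> R) (B : R) :
  measurable_fun setT f -> (forall x, `|f x| <= B) ->
  square_integrable (Fn L F1 n) f.
Proof.
move=> mf fB; split; first exact: measurable_funTS.
have mD := measurable_Fn hF n.
apply: (@le_lt_trans _ _ (\int[mu]_(x in Fn L F1 n) (B ^+ 2)%:E)%E).
  apply: ge0_le_integral => //.
  - by move=> x _; rewrite lee_fin sqr_ge0.
  - apply/measurable_EFinP; apply: measurable_funTS.
    by under eq_fun do rewrite expr2; exact: measurable_funM.
  - move=> x _; rewrite lee_fin -(real_normK (num_real (f x))).
    by rewrite lerXn2r ?nnegrE// (le_trans _ (fB x)).
rewrite integral_cst//; apply: lte_mul_pinfty => //; last exact: lebesgue_Fn_lty.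
by rewrite lee_fin sqr_ge0.
Qed.

Lemma integral_sqr_cantor_deriv n :
  (\int[mu]_(x in Fn L F1 n) (cantor_deriv L n (x ord0 ord0) ^+ 2)%:E <=
   (4 * ((l / 2) ^+ 2 * #|T|%:R / l ^+ d.+1) ^+ n)%:E)%E.
Proof.
set r : R := l^-1 ^+ n.
have r0 : 0 <= r by rewrite exprn_ge0// invr_ge0 ltW.
have [mK muK] := measure_union_boxes (cover_corners n) r0.
set K := \big[setU/set0]_(a <- _) _ in mK muK.
pose M := 2 * (l / 2) ^+ n.
have M0 : 0 <= M by rewrite mulr_ge0// exprn_ge0// divr_ge0 ?ltW.
have mD := measurable_Fn hF n.
have mdc : measurable_fun setT (fun x : 'rV[R]_d.+1 => (cantor_deriv L n (x ord0 ord0) ^+ 2)%:E).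
  apply/measurable_EFinP; apply: (measurableT_comp (f := fun t : R => t ^+ 2)) => //.
  exact: measurableT_comp
    (continuous_measurable_fun (@continuous_cantor_deriv _ _ _)) (measurable_coord ord0).
apply: (@le_trans _ _ (\int[mu]_(x in K) (M ^+ 2)%:E)%E).
  rewrite integral_mkcond [leRHS]integral_mkcond; apply: ge0_le_integral => //.
  - by move=> x _; rewrite /patch; case: ifP => // _; rewrite lee_fin sqr_ge0.
  - by apply/(measurable_restrictT _ mD); exact: measurable_funTS.
  - by apply/(measurable_restrictT _ mK); exact: measurable_cst.
  - move=> x _; rewrite /patch; case: ifPn => [/set_mem Fx|_]; last first.
      by case: ifP => // _; rewrite lee_fin sqr_ge0.
    have [->|dx] := eqVneq (cantor_deriv L n (x ord0 ord0)) 0.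
      by rewrite expr0n; case: ifP => // _; rewrite lee_fin sqr_ge0.
    have [a aC xa] := cover_cantor_deriv_support Fx dx.
    have -> : x \in K by rewrite inE /K -bigcup_seq; exists a.
    have /andP[h1 h2] := cantor_deriv_itv L2 n (x ord0 ord0).
    by rewrite lee_fin lerXn2r// nnegrE.
rewrite integral_cst//.
(* [M] bounds the derivative, and [K] covers its support in F_n. *)
apply: (le_trans (lee_wpmul2l _ muK)); first by rewrite lee_fin sqr_ge0.
rewrite -EFinM lee_fin size_cover_corners natrX /M /r.
have E (h t v : R) : (2 * h ^+ n) ^+ 2 * (t ^+ n * (v ^+ n) ^+ d.+1) =
    4 * (h ^+ 2 * t * v ^+ d.+1) ^+ n.
  rewrite !exprMn -!exprM !(mulnC n) !mulrA mul2n -addnn exprD !mulrA.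
  by rewrite -natrX.
by rewrite E exprVn.
Qed.

Lemma min_energy_le n :
  (min_energy L F1 n <= (4 * ((l / 2) ^+ 2 * #|T|%:R / l ^+ d.+1) ^+ n)%:E)%E.
Proof.
apply: le_trans (integral_sqr_cantor_deriv n).
pose u (x : 'rV[R]_d.+1) := cantor_fun L n (x ord0 ord0).
pose G (i : 'I_d.+1) (x : 'rV[R]_d.+1) :=
  if i == ord0 then cantor_deriv L n (x ord0 ord0) else 0.
pose A : R := Num.max 1 (2 * (l / 2) ^+ n).
have cgA t : `|cantor_fun L n t| <= A.
  have /andP[h1 h2] := cantor_fun_itv L n t.
  by rewrite ger0_norm// le_max h2.
have dgA t : `|cantor_deriv L n t| <= A.
  have /andP[h1 h2] := cantor_deriv_itv L2 n t.
  by rewrite ger0_norm// le_max h2 orbT.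
have cg : continuous (@cantor_fun R L n).
  move=> t; apply: differentiable_continuous; apply/derivable1_diffP.
  by have [] := is_derive_cantor_fun L n t.
have cdg := @continuous_cantor_deriv R L n.
apply: ereal_inf_lbound; exists u, G; split.
- split.
    apply: (square_integrable_bounded _ (B := A)) => [|x]; last exact: cgA.
    exact: measurableT_comp (continuous_measurable_fun cg) (measurable_coord ord0).
  move=> i; split.
    apply: (square_integrable_bounded _ (B := A)) => [|x].
      rewrite /G; case: (i == ord0); last exact: measurable_cst.
      exact: measurableT_comp (continuous_measurable_fun cdg) (measurable_coord ord0).
    by rewrite /G; case: (i == ord0); rewrite // normr0 le_max ler01.
  apply: (@weak_partial_ridge _ _ _ _ _ _ A) => // t; exact: is_derive_cantor_fun.
- apply: continuous_subspaceT => x.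
  by apply: (continuous_comp (@coord_continuous _ _ _ ord0 ord0 x)); exact: cg.
- by move=> x [_ x0]; rewrite /u x0// cantor_fun_le0.
- by move=> x [_ x1]; rewrite /u x1// cantor_fun_ge1.
- apply: eq_integral => x _; congr EFin.
  rewrite (bigD1 ord0)//= big1 ?addr0// => i i0.
  by rewrite /G (negbTE i0) expr0n.
Qed.

End energy_bound.

Lemma exprn_bounded_below_ge1 (R : realType) (x c : R) :
  0 < c -> 0 <= x -> (forall n, c <= x ^+ n) -> 1 <= x.
Proof.
move=> c0 x0 cx; rewrite leNgt; apply/negP => x1.
have : (fun n => x ^+ n) @ \oo --> (0 : R) by apply: cvg_expr; rewrite ger0_norm.
move=> /cvgr_lt /(_ _ c0)[n _ /(_ n (leqnn n))] /=.
by rewrite ltNge cx.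
Qed.

(** The energy bound turns the lower bound in the definition of rho into
    C^-1 <= 4 (rho t / 4)^n for all n, where t <= 2 m_I is the number of cubes in
    the two extreme layers; hence rho t / 4 >= 1. *)
Lemma resistance_scaling_ge (R : realType) (d L : nat) (F1 : set 'rV[R]_d)
    (hF : is_GSC L F1) (rho : R) :
  is_resistance_scaling L F1 rho -> 2 <= rho * (m_I L F1)%:R.
Proof.
case: d F1 hF => [|d] F1 hF; first by have := GSC_dim hF.
move=> [rho0 [C C1 hC]].
have L2 : (2 <= L)%N := ltnW (GSC_scale hF).
have l0 : 0 < L%:R :> R by rewrite ltr0n (leq_trans _ L2).
have l2 : 2 <= L%:R :> R by rewrite ler_nat.
set t : R := #|end_layers L F1|%:R.
have C0 : 0 < C by exact: lt_le_trans C1.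
have ge1 : 1 <= rho * t / 4.
  apply: (@exprn_bounded_below_ge1 _ _ (C^-1 / 4)).
  - by rewrite divr_gt0// invr_gt0.
  - by rewrite divr_ge0// mulr_ge0// ltW.
  move=> n; have /andP[h _] := hC n.
  have /(le_trans h) : (((rho * L%:R ^+ (d.+1 - 2)) ^+ n)%:E * min_energy L F1 n <=
     ((rho * L%:R ^+ (d.+1 - 2)) ^+ n)%:E *
       (4 * ((L%:R / 2) ^+ 2 * t / L%:R ^+ d.+1) ^+ n)%:E)%E.
    apply: lee_wpmul2l; last exact: min_energy_le.
    by rewrite lee_fin exprn_ge0// mulr_ge0 ?exprn_ge0// ltW.
  rewrite -EFinM lee_fin mulrCA -exprMn.
  have d2 := GSC_dim hF.
  rewrite [X in X ^+ n](_ : _ = rho * t / 4).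
    by rewrite ler_pdivrMr// mulrC.
  rewrite -{2}(subnK d2) exprD; field.
  by rewrite expf_neq0 gt_eqF.
have : t <= 2 * (m_I L F1)%:R.
  rewrite -natrM ler_nat (leq_trans (card_end_layers_le hF))// leq_mul2l.
  exact: card_first_layer_le.
nra.
Qed.

Theorem lemma3p7 (R : realType) (d L : nat) (F1 : set 'rV[R]_d)
    (hF : is_GSC L F1) (rho : R) (hrho : is_resistance_scaling L F1 rho) :
  d_I L F1 > d_f L F1 - d_w L F1 rho.
Proof.
have rho0 : 0 < rho := hrho.1.
have mI := resistance_scaling_ge hF hrho.
have mI0 : 0 < (m_I L F1)%:R :> R by rewrite -(pmulr_rgt0 _ rho0); lra.
have mF0 : 0 < (m_F L F1)%:R :> R.
  by move: F1 hF {hrho mI mI0}; case: d => [|d'] F1 hF;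
    [have := GSC_dim hF|rewrite ltr0n; exact: m_F_gt0].
have lnL : 0 < ln (L%:R : R).
  by rewrite ln_gt0// ltr1n; exact: leq_trans (GSC_scale hF).
rewrite /d_I /d_f /d_w -mulrBl ltr_pM2r ?invr_gt0//.
rewrite lnM ?posrE// opprD addrCA subrr addr0 -lnV ?posrE//.
rewrite ltr_ln ?posrE ?invr_gt0//.
by rewrite -(ltr_pM2l rho0) mulfV ?gt_eqF//; lra.
Qed.
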